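(* Let $d>2$ and let $J_x,J_y$ be the generators of rotations in the irreducible spin-$J$ representation of $SU(2)$ on a $d$-dimensional Hilbert space, so $d=2J+1$. Let $h$ be a traceless Hermitian operator on this space such that there exists $q\in\{-2,\dots,2\}$ with $\mathrm{Tr}\big(h\,T^{(2)}_q\big)\neq 0$. Then the Lie algebra generated by $\{J_x,J_y,h\}$ is $\mathfrak{su}(d)$.
   Context: For the spin-$J$ representation with basis $\{|J,m\rangle\}_{m=-J}^{J}$, the irreducible spherical tensor operators are $T^{(k)}_q(J)=\sqrt{\frac{2k+1}{2J+1}}\sum_m \langle J,m+q|k,q;J,m\rangle\,|J,m+q\rangle\langle J,m|$ for $0\le k\le 2J$, $-k\le q\le k$, where $\langle J,m+q|k,q;J,m\rangle$ are Clebsch–Gordan coefficients; they form an orthonormal operator basis for the trace inner product. ''The Lie algebra generated by a set of Hermitian operators $\{H_1,\dots,H_n\}$'' means the smallest real vector space of operators containing $-iH_1,\dots,-iH_n$ and closed under commutators; $\mathfrak{su}(d)$ is the Lie algebra of traceless anti-Hermitian $d\times d$ matrices. *)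

(* Defs.v *)
From HB Require Import structures.
From mathcomp Require Import all_boot all_order all_algebra.
From mathcomp Require Import complex.
From mathcomp Require Import reals.
Set Implicit Arguments. Unset Strict Implicit. Unset Printing Implicit Defensive.
Import Order.TTheory GRing.Theory Num.Theory.
Local Open Scope ring_scope.

Section Spin.
Variable C : numClosedFieldType.
Variable d : nat.

Definition hadj (X : 'M[C]_d) : 'M[C]_d := \matrix_(i, j) (X j i)^*.

(* Basis index a : 'I_d  <->  |J, m> with m = a - J, J = (d-1)/2.
   J_+ |J,m> = sqrt((J-m)(J+m+1)) |J,m+1>, and (J-m)(J+m+1) = (d-1-a)(a+1). *)
Definition Jplus : 'M[C]_d :=
  \matrix_(i, j) if (i : nat) == (j : nat).+1
                 then sqrtC ((((d.-1 - j) * j.+1)%N)%:R) else 0.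
Definition Jminus : 'M[C]_d := hadj Jplus.
Definition Jx : 'M[C]_d := 2^-1 *: (Jplus + Jminus).
Definition Jy : 'M[C]_d := (2 * 'i)^-1 *: (Jplus - Jminus).

(* factorial of an integer (0 on negatives) and its reciprocal
   (1/n! := 0 for n < 0, the usual convention in the Racah formula) *)
Definition zfact (z : int) : C := if (0 <= z) then ((`|z|%N)`!)%:R else 0.
Definition ifact (z : int) : C := if (0 <= z) then ((`|z|%N)`!)%:R^-1 else 0.

(* Clebsch--Gordan coefficient <J, m+q | k, q ; J, m>, with J = (d-1)/2,
   m = a - J (so J + m = a), given by Racah's formula
   <j1 m1; j2 m2 | j M> with j1 = k, m1 = q, j2 = J, m2 = m, j = J, M = m + q. *)
Definition CG (k : nat) (q : int) (a : int) : C :=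
  let D : int := (d%:Z - 1) in
  sqrtC (d%:R * zfact k%:Z * zfact (D - k%:Z) * zfact k%:Z / zfact (k%:Z + d%:Z)) *
  sqrtC (zfact (a + q) * zfact (D - a - q) * zfact (k%:Z - q) * zfact (k%:Z + q)
         * zfact (D - a) * zfact a) *
  \sum_(s < k.+1)
     (-1) ^+ s * ifact s%:Z * ifact (k%:Z - s%:Z) * ifact (k%:Z - q - s%:Z)
       * ifact (a - s%:Z) * ifact (q + s%:Z) * ifact (D - k%:Z - a + s%:Z).

(* Irreducible spherical tensor operator T^(k)_q(J)
   = sqrt((2k+1)/(2J+1)) sum_m <J,m+q|k,q;J,m> |J,m+q><J,m|. *)
Definition Tsph (k : nat) (q : int) : 'M[C]_d :=
  \matrix_(i, j) if (i : nat)%:Z == (j : nat)%:Z + q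
                 then sqrtC ((k.*2.+1)%:R / d%:R) * CG k q (j : nat)%:Z else 0.

Definition lie_closed (S : 'M[C]_d -> Prop) : Prop :=
  (forall (a : C) X Y, a \is Num.real -> S X -> S Y -> S (a *: X + Y)) /\
  (forall X Y, S X -> S Y -> S (X *m Y - Y *m X)).

Definition lie_generated (gens : seq 'M[C]_d) (X : 'M[C]_d) : Prop :=
  forall S, lie_closed S -> (forall G, G \in gens -> S G) -> S X.

Definition su (X : 'M[C]_d) : Prop := hadj X = - X /\ \tr X = 0.

End Spin.
Arguments Jx {C d}. Arguments Jy {C d}. Arguments Jplus {C d}. Arguments Jminus {C d}.
Arguments Tsph {C d}.

(* Main.v *)
(* Complexifying, it suffices that the complex Lie algebra W generated by J+, J-
   and h is sl(d): an anti-Hermitian A + iB with A, B anti-Hermitian equals A.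
   Orthogonality to J+^2 for the Hilbert-Schmidt product passes, by invariance
   of the trace form under ad J+, to all T^(2)_q; hence W is not orthogonal to
   J+^2.  The self-adjoint operator (ad 2Jz - 4)^2 + (ad J-)(ad J+) preserves W,
   has kernel spanned by J+^2 and image orthogonal to it; were it injective on W,
   W would be contained in its image.  So W contains J+^2, and then, by applying
   ad J- twice, a diagonal matrix Q, quadratic in Jz.  The consecutive differences
   of the entries of Q are distinct, so polynomials in ad Q extract from J+ and J-
   all the matrix units next to the diagonal, and these generate sl(d). *)

Require Import Defs.
From HB Require Import structures.
From mathcomp Require Import all_boot all_order all_algebra.
From mathcomp Require Import complex.
From mathcomp Require Import boolp reals.
From mathcomp Require Import zify ring.
Set Implicit Arguments. Unset Strict Implicit. Unset Printing Implicit Defensive.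
Import Order.TTheory GRing.Theory Num.Theory.
Local Open Scope ring_scope.

(** Start from 0 and adjoin a missing vector of [S] as long as one exists; [k] bounds the
    codimension. Dimension counts thus become available for a Lie algebra given only as a
    predicate. *)
Lemma subspace_vspace (K : fieldType) (vT : vectType K) (S : vT -> Prop) :
  S 0 -> (forall a x y, S x -> S y -> S (a *: x + y)) ->
  exists U : {vspace vT}, forall x, x \in U <-> S x.
Proof.
move=> S0 Slin.
suff IH k (U : {vspace vT}) : (forall x, x \in U -> S x) ->
    (\dim {:vT} - \dim U < k)%N -> exists V : {vspace vT}, forall x, x \in V <-> S x.
  by apply: (IH _ 0%VS) (ltnSn _) => x; rewrite memv0 => /eqP ->.
elim: k U => // k IHk U US dimU.
have [SU|] := pselect (forall x, S x -> x \in U).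
  by exists U => x; split; [exact: US | exact: SU].
move=> /existsNP[x /not_implyP[Sx /negP xU]].
apply: (IHk (<[x]> + U)%VS).
  move=> y /memv_addP[u /vlineP[a ->] [v vU ->]].
  by apply: Slin => //; exact: US.
have lt : (\dim U < \dim (<[x]> + U))%N.
  rewrite ltn_neqAle dimvS ?addvSr // andbT.
  apply: contra xU => /eqP dimE.
  have /eqP -> : U == (<[x]> + U)%VS by rewrite eqEdim addvSr dimE leqnn.
  by rewrite (subvP (addvSl _ _)) ?memv_line.
have := dimvS (subvf (<[x]> + U)%VS); lia.
Qed.

(* Locked, since otherwise rewriting with additivity lemmas unfolds it. *)
HB.lock Definition comm (K : comNzRingType) n (X Y : 'M[K]_n) : 'M[K]_n :=
  X *m Y - Y *m X.

(** * Commutators and invariance of the trace form *)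

Section Comm.
Variables (K : comNzRingType) (n : nat).
Implicit Types X Y Z : 'M[K]_n.

Lemma commE X Y : comm X Y = X *m Y - Y *m X.
Proof. by rewrite comm.unlock. Qed.

Lemma commMl X Y Z : comm (X *m Y) Z = X *m comm Y Z + comm X Z *m Y.
Proof. by rewrite !commE mulmxBr mulmxBl !mulmxA addrA subrK. Qed.

Lemma commMr X Y Z : comm X (Y *m Z) = comm X Y *m Z + Y *m comm X Z.
Proof. by rewrite !commE mulmxBr mulmxBl !mulmxA addrA subrK. Qed.

Lemma commDl X Y Z : comm (X + Y) Z = comm X Z + comm Y Z.
Proof. by rewrite !commE mulmxDr mulmxDl opprD addrACA. Qed.

Lemma commDr X Y Z : comm X (Y + Z) = comm X Y + comm X Z.
Proof. by rewrite !commE mulmxDr mulmxDl opprD addrACA. Qed.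

Lemma commZl a X Y : comm (a *: X) Y = a *: comm X Y.
Proof. by rewrite !commE -scalemxAl -scalemxAr -scalerBr. Qed.

Lemma commZr a X Y : comm X (a *: Y) = a *: comm X Y.
Proof. by rewrite !commE -scalemxAl -scalemxAr -scalerBr. Qed.

Lemma commC X Y : comm X Y = - comm Y X.
Proof. by rewrite !commE opprB. Qed.

Lemma commxx X : comm X X = 0.
Proof. by rewrite commE subrr. Qed.

Lemma mxtrace_comm X Y : \tr (comm X Y) = 0.
Proof. by rewrite !commE raddfB /= mxtrace_mulC subrr. Qed.

(** Cyclicity of the trace. This is what moves ad across the trace form in every orthogonality
    argument below. *)
Lemma mxtrace_comm_mul X Y Z : \tr (X *m comm Y Z) = \tr (comm X Y *m Z).
Proof.
rewrite !commE mulmxBr mulmxBl !raddfB /= !mulmxA; congr (_ - _).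
by rewrite mxtrace_mulC mulmxA.
Qed.

End Comm.

(** * Adjoints and the Hilbert-Schmidt form *)

Section Adjoint.
Variables (C : numClosedFieldType) (n : nat).
Implicit Types X Y : 'M[C]_n.

Lemma hadjD X Y : hadj (X + Y) = hadj X + hadj Y.
Proof. by apply/matrixP=> i j; rewrite !mxE rmorphD. Qed.

Lemma hadjZ a X : hadj (a *: X) = a^* *: hadj X.
Proof. by apply/matrixP=> i j; rewrite !mxE rmorphM. Qed.

Lemma hadjB X Y : hadj (X - Y) = hadj X - hadj Y.
Proof. by apply/matrixP=> i j; rewrite !mxE rmorphB. Qed.

Lemma hadjK X : hadj (hadj X) = X.
Proof. by apply/matrixP=> i j; rewrite !mxE conjCK. Qed.

Lemma hadjM X Y : hadj (X *m Y) = hadj Y *m hadj X.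
Proof.
apply/matrixP=> i j; rewrite !mxE rmorph_sum /=; apply: eq_bigr => k _.
by rewrite !mxE rmorphM mulrC.
Qed.

Lemma hadj_comm X Y : hadj (comm X Y) = comm (hadj Y) (hadj X).
Proof. by rewrite !commE hadjB !hadjM. Qed.

Lemma mxtrace_hadj X : \tr (hadj X) = (\tr X)^*.
Proof. by rewrite /mxtrace rmorph_sum; apply: eq_bigr => i _; rewrite mxE. Qed.

Lemma mxtrace_hadj_ge0 X : 0 <= \tr (hadj X *m X).
Proof.
apply: sumr_ge0 => i _; rewrite mxE; apply: sumr_ge0 => j _.
by rewrite mxE mulrC mul_conjC_ge0.
Qed.

Lemma mxtrace_hadj_eq0 X : \tr (hadj X *m X) = 0 -> X = 0.
Proof.
move=> tr0; apply/matrixP=> i j; rewrite mxE.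
have ge0 k l : 0 <= hadj X k l * X l k by rewrite mxE mulrC mul_conjC_ge0.
have diag0 : (hadj X *m X) j j = 0.
  by apply: (psumr_eq0P _ tr0) => // k _; rewrite mxE sumr_ge0.
rewrite mxE in diag0; have /(_ i isT)/eqP := psumr_eq0P (fun k _ => ge0 j k) diag0.
by rewrite mxE mulrC mul_conjC_eq0 => /eqP.
Qed.

End Adjoint.

(** * Shifted diagonal matrices *)

Section Shift.
Variables (K : comNzRingType) (n : nat).
Implicit Types f g : nat -> K.

(** In both [up] and [dn] a coefficient is indexed by the smaller of the row and column indices.
    Functions on [nat] allow shifts without bound proofs; only values at j + p < n count. *)
Definition up p f : 'M[K]_n :=
  \matrix_(i, j) if (i : nat) == (j + p)%N then f j else 0.
Definition dn p f : 'M[K]_n := (up p f)^T.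

Lemma up_ext p f g :
  (forall j, (j + p < n)%N -> f j = g j) -> up p f = up p g.
Proof.
move=> fg; apply/matrixP=> i j; rewrite !mxE; case: eqP => // ij.
by rewrite fg // -ij.
Qed.

Lemma dn_ext p f g :
  (forall j, (j + p < n)%N -> f j = g j) -> dn p f = dn p g.
Proof. by move=> fg; rewrite /dn (up_ext fg). Qed.

Lemma up_mul p q f g :
  up p f *m up q g = up (q + p) (fun j => f (j + q)%N * g j).
Proof.
apply/matrixP=> i j; rewrite !mxE; case: eqP => ij.
  have lt : (j + q < n)%N by have := ltn_ord i; lia.
  rewrite (bigD1 (Ordinal lt)) //= !mxE /= ij addnA !eqxx.
  rewrite big1 ?addr0 // => k; rewrite -val_eqE /= => kj.
  by rewrite !mxE (negbTE kj) mulr0.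
apply: big1 => k _; rewrite !mxE; case: eqP => ik; rewrite ?mul0r //.
by case: eqP => kj; rewrite ?mulr0 //; lia.
Qed.

Lemma dn_mul p q f g :
  dn p f *m dn q g = dn (p + q) (fun j => f j * g (j + p)%N).
Proof.
by rewrite /dn -trmx_mul up_mul; congr (_^T); apply: up_ext => j _; rewrite mulrC.
Qed.

Lemma up_dn p f g :
  up p f *m dn p g = up 0 (fun j => if (p <= j)%N then f (j - p)%N * g (j - p)%N else 0).
Proof.
apply/matrixP=> i j; rewrite !mxE addn0; case: eqP => ij; last first.
  apply: big1 => k _; rewrite !mxE; case: eqP => ik; rewrite ?mul0r //.
  by case: eqP => kj; rewrite ?mulr0 //; lia.
case: leqP => pj.
  have lt : (j - p < n)%N by have := ltn_ord j; lia.
  rewrite (bigD1 (Ordinal lt)) //= !mxE /= ij subnK // !eqxx.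
  rewrite big1 ?addr0 // => k; rewrite -val_eqE /= => kj.
  by rewrite !mxE; case: eqP => // jk; rewrite ?mul0r //; lia.
apply: big1 => k _; rewrite !mxE; case: eqP => ik; rewrite ?mul0r //; lia.
Qed.

Lemma dn_up p f g :
  dn p f *m up p g = up 0 (fun j => if (j + p < n)%N then f j * g j else 0).
Proof.
apply/matrixP=> i j; rewrite !mxE addn0; case: eqP => ij; last first.
  apply: big1 => k _; rewrite !mxE; case: eqP => ik; rewrite ?mul0r //.
  by case: eqP => kj; rewrite ?mulr0 //; lia.
case: ifP => pj.
  rewrite (bigD1 (Ordinal pj)) //= !mxE /= ij !eqxx.
  rewrite big1 ?addr0 // => k; rewrite -val_eqE /= => kj.
  by rewrite !mxE; case: eqP => // jk; rewrite ?mul0r //; lia.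
apply: big1 => k _; rewrite !mxE; case: eqP => ik; rewrite ?mul0r //.
by have := ltn_ord k; lia.
Qed.

Lemma up_mulE p f (X : 'M[K]_n) (i j k : 'I_n) :
  (i : nat) = (k + p)%N -> (up p f *m X) i j = f k * X k j.
Proof.
move=> ik; rewrite mxE (bigD1 k) //= mxE ik eqxx big1 ?addr0 // => l lk.
by rewrite mxE ik eqn_add2r eq_sym val_eqE (negbTE lk) mul0r.
Qed.

Lemma mul_upE p f (X : 'M[K]_n) (i j k : 'I_n) :
  (k : nat) = (j + p)%N -> (X *m up p f) i j = X i k * f j.
Proof.
move=> kj; rewrite mxE (bigD1 k) //= mxE kj eqxx big1 ?addr0 // => l lk.
by rewrite mxE -kj val_eqE (negbTE lk) mulr0.
Qed.

Lemma comm_diagE f (X : 'M[K]_n) i j : comm (up 0 f) X i j = (f i - f j) * X i j.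
Proof.
rewrite commE mxE (@up_mulE 0 f X i j i) ?addn0 //.
by rewrite mxE (@mul_upE 0 f X i j j) ?addn0 // mulrBl (mulrC (f j)).
Qed.

Lemma dn0 f : dn 0 f = up 0 f.
Proof.
apply/matrixP=> i j; rewrite !mxE !addn0 eq_sym; case: eqP => // ij.
by congr f.
Qed.

Lemma upD p f g : up p f + up p g = up p (fun j => f j + g j).
Proof. by apply/matrixP=> i j; rewrite !mxE; case: eqP => _; rewrite ?addr0. Qed.

Lemma upN p f : - up p f = up p (fun j => - f j).
Proof. by apply/matrixP=> i j; rewrite !mxE; case: eqP => _; rewrite ?oppr0. Qed.

Lemma upZ a p f : a *: up p f = up p (fun j => a * f j).
Proof. by apply/matrixP=> i j; rewrite !mxE; case: eqP => _; rewrite ?mulr0. Qed.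

Lemma dnD p f g : dn p f + dn p g = dn p (fun j => f j + g j).
Proof. by rewrite /dn -raddfD upD. Qed.

Lemma dnN p f : - dn p f = dn p (fun j => - f j).
Proof. by rewrite /dn -raddfN upN. Qed.

Lemma dnZ a p f : a *: dn p f = dn p (fun j => a * f j).
Proof. by rewrite /dn -linearZ upZ. Qed.

End Shift.

(** * Spin operators, weights and the rank-two multiplet *)

Section SpinOperators.
Variables (C : numClosedFieldType) (n : nat).
Local Notation d := n.+3.
Implicit Types X Y Z : 'M[C]_d.

Local Notation P := (Jplus : 'M[C]_d).
Local Notation M := (Jminus : 'M[C]_d).

(** The matrix element of J+ out of column j; since d = [n.+3], 2J is [n.+2]. *)
Definition ladder (j : nat) : C := sqrtC ((((n.+2 - j) * j.+1)%N)%:R).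
(* Twice [J_z], which avoids the half-integer weights. *)
Definition weight (j : nat) : C := 2 * j%:R - n.+2%:R.
Definition J2z : 'M[C]_d := up d 0 weight.
Local Notation H := J2z.

Lemma ladder_sq j : ladder j * ladder j = ((n.+2 - j) * j.+1)%:R.
Proof. by rewrite -expr2 sqrtCK. Qed.

Lemma ladder_neq0 j : (j < n.+2)%N -> ladder j != 0.
Proof. by move=> jn; rewrite sqrtC_eq0 pnatr_eq0 muln_eq0; lia. Qed.

Lemma JplusE : P = up d 1 ladder.
Proof. by apply/matrixP=> i j; rewrite !mxE addn1. Qed.

Lemma JminusE : M = dn d 1 ladder.
Proof.
apply/matrixP=> i j; rewrite !mxE addn1; case: eqP => _; last by rewrite rmorph0.
by apply/CrealP; rewrite realE sqrtC_ge0 ler0n.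
Qed.

Lemma hadj_Jplus : hadj P = M. Proof. by []. Qed.
Lemma hadj_Jminus : hadj M = P. Proof. exact: hadjK. Qed.

Lemma hadj_J2z : hadj H = H.
Proof.
apply/matrixP=> i j; rewrite !mxE !addn0 eq_sym; case: eqP => [ij|_]; last by rewrite rmorph0.
by rewrite ij rmorphB rmorphM !rmorph_nat.
Qed.

Lemma JplusJminus : P *m M = up d 0 (fun j => ((n.+3 - j) * j)%:R).
Proof.
rewrite JplusE JminusE up_dn; apply: up_ext => -[|j] jd //; first by rewrite muln0.
by rewrite subn1 /= ladder_sq subSS.
Qed.

Lemma JminusJplus : M *m P = up d 0 (fun j => ((n.+2 - j) * j.+1)%:R).
Proof.
rewrite JplusE JminusE dn_up; apply: up_ext => j; rewrite addn0 => jd.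
case: ifP => jp; first by rewrite ladder_sq.
(* At the top index j = [n.+2] the coefficient vanishes, as J+ kills the highest weight vector. *)
by have -> : (n.+2 - j = 0)%N by lia.
Qed.


Lemma comm_Jplus_Jminus : comm P M = H.
Proof.
rewrite commE JplusJminus JminusJplus upN upD; apply: up_ext => j.
by rewrite addn0 => jd; rewrite /weight !natrM !natrB; [ring | lia | lia].
Qed.

Lemma comm_J2z_Jplus : comm H P = 2 *: P.
Proof.
rewrite commE JplusE !up_mul upN upD upZ; apply: up_ext => j jd.
by rewrite ?addn0 /weight natrD; ring.
Qed.

Lemma comm_J2z_Jminus : comm H M = - 2 *: M.
Proof.
rewrite commE JminusE /J2z -dn0 !dn_mul dnN dnD dnZ; apply: dn_ext => j jd.
by rewrite ?addn0 /weight natrD; ring.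
Qed.

(** This is 4 (3 Jz^2 - J^2), the component q = 0 of the rank-two multiplet up to a scalar. *)
Definition Jquad : 'M[C]_d := 2 *: (H *m H) - 2 *: (P *m M + M *m P).
Local Notation Q := Jquad.

(** With the next three lemmas, ad J+ climbs from J-^2 to J+^2 through the five components of the
    rank-two multiplet, up to nonzero scalars. *)
Lemma comm_Jplus_JminusJminus : comm P (M *m M) = H *m M + M *m H.
Proof. by rewrite commMr comm_Jplus_Jminus. Qed.

Lemma comm_Jplus_J2zJminus : comm P (H *m M + M *m H) = Q.
Proof.
rewrite commDr !commMr comm_Jplus_Jminus (commC P H) comm_J2z_Jplus.
rewrite -!scaleNr -!scalemxAl -!scalemxAr /Jquad; apply/matrixP=> i j; rewrite !mxE; ring.
Qed.

Lemma comm_Jplus_Jquad : comm P Q = - 6 *: (P *m H + H *m P).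
Proof.
rewrite /Jquad -scaleNr !(commDr, commZr) !commMr comm_Jplus_Jminus (commC P H) comm_J2z_Jplus.
rewrite commxx mulmx0 mul0mx.
by rewrite -!scaleNr -!scalemxAl -!scalemxAr; apply/matrixP=> i j; rewrite !mxE; ring.
Qed.

Lemma comm_Jplus_J2zJplus : comm P (P *m H + H *m P) = - 4 *: (P *m P).
Proof.
rewrite commDr !commMr (commC P H) comm_J2z_Jplus commxx mulmx0 mul0mx.
by rewrite -!scaleNr -!scalemxAl -!scalemxAr; apply/matrixP=> i j; rewrite !mxE; ring.
Qed.

(** With the next lemma, the descent from J+^2 to the diagonal operator [Jquad]. *)
Lemma comm_JplusJplus_Jminus : comm (P *m P) M = P *m H + H *m P.
Proof. by rewrite commMl comm_Jplus_Jminus. Qed.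

Lemma comm_J2zJplus_Jminus : comm (P *m H + H *m P) M = Q.
Proof.
rewrite commDl !commMl comm_Jplus_Jminus comm_J2z_Jminus.
rewrite -!scalemxAl -!scalemxAr /Jquad; apply/matrixP=> i j; rewrite !mxE; ring.
Qed.

(** With m = j - J this is 12 m^2 - 4 J (J + 1). *)
Definition quad (j : nat) : C :=
  12 * j%:R * (j%:R - n.+2%:R) + 2 * n.+2%:R * (n.+2%:R - 1).

Lemma JquadE : Q = up d 0 quad.
Proof.
rewrite /Jquad JplusJminus JminusJplus up_mul upD !upZ upN upD; apply: up_ext => j.
by rewrite !addn0 => jd; rewrite /quad /weight !natrM !natrB; [ring | lia | lia].
Qed.

Lemma comm_J2z_JminusJminus : comm H (M *m M) = - 4 *: (M *m M).
Proof.
rewrite commMr comm_J2z_Jminus -!scalemxAl -!scalemxAr.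
by apply/matrixP=> i j; rewrite !mxE; ring.
Qed.

(** The weight condition confines X to the entries (j + 2, j). Commuting with J+ is then a
    first-order recursion along them, which J+^2 also satisfies, so the first entry determines X. *)
Lemma highest_weight X : comm H X = 4 *: X -> comm P X = 0 ->
  exists c, X = c *: (P *m P).
Proof.
move=> HX PX.
have Xshift (i j : 'I_d) : (i : nat) != (j + 2)%N -> X i j = 0.
  move=> ij; move/matrixP: HX => /(_ i j); rewrite comm_diagE mxE.
  move=> /eqP; rewrite -subr_eq0 -mulrBl mulf_eq0 => /orP[|/eqP //].
  have -> : weight i - weight j - 4 = 2 * (i%:R - (j + 2)%:R).
    by rewrite /weight natrD; ring.
  by rewrite mulf_eq0 pnatr_eq0 /= subr_eq0 eqr_nat (negbTE ij).
pose x j := X (inord (j + 2)) (inord j).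
(* The entry (j + 3, j) of the equation [J+, X] = 0. *)
have xS j : (j < n)%N -> ladder (j + 2) * x j = x j.+1 * ladder j.
  move=> jn; move/matrixP: PX => /(_ (inord (j + 3)) (inord j)); rewrite commE JplusE.
  rewrite mxE (@up_mulE _ _ 1 _ _ _ _ (inord (j + 2))) ?inordK; try lia.
  rewrite mxE (@mul_upE _ _ 1 _ _ _ _ (inord j.+1)) ?inordK ?mxE; try lia.
  by rewrite /x addSnnS => /eqP; rewrite subr_eq0 => /eqP.
pose c := x 0%N / (ladder 0 * ladder 1).
have xE j : (j <= n)%N -> x j = c * (ladder j.+1 * ladder j).
  elim: j => [|j IHj] jn.
    by rewrite /c [ladder 1 * _]mulrC divfK // mulf_neq0 // ladder_neq0.
  apply: (mulIf (ladder_neq0 (_ : j < n.+2)%N)); first by lia.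
  by rewrite -xS // IHj ?(ltnW jn) // addn2; ring.
exists c; rewrite JplusE up_mul; apply/matrixP=> i j; rewrite 2!mxE.
case: eqP => [ij|/eqP ij]; last by rewrite mulr0 Xshift.
rewrite addn1 -xE; last by have := ltn_ord i; lia.
by rewrite /x -ij !inord_val.
Qed.

Definition shiftH X := comm H X - 4 *: X.
(** For the Hilbert-Schmidt product [shiftH] is self-adjoint and ad J- is the adjoint of ad J+. The
    operator is therefore positive, and it detects the highest weight vectors of weight 4 for ad
    2Jz. *)
Definition highest_op X := shiftH (shiftH X) + comm M (comm P X).

Lemma highest_op_linear : linear highest_op.
Proof.
have shiftH_linear : linear shiftH.
  move=> a X Y; rewrite /shiftH commDr commZr.
  by move: (comm H X) (comm H Y) => U V; apply/matrixP=> i j; rewrite !mxE; ring.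
move=> a X Y; rewrite /highest_op !shiftH_linear (commDr P) (commZr a P).
by rewrite (commDr M (a *: _)) (commZr a M) addrACA -(scalerDr a (shiftH _)).
Qed.

HB.instance Definition _ := GRing.isLinear.Build C 'M[C]_d 'M[C]_d _ highest_op highest_op_linear.

(** Pairing with X gives the sum of the squared norms of [shiftH X] and [J+, X], so both vanish. *)
Lemma highest_op_eq0 X : highest_op X = 0 -> exists c, X = c *: (P *m P).
Proof.
have trH Y Z : \tr (hadj Y *m shiftH Z) = \tr (hadj (shiftH Y) *m Z).
  rewrite hadjB hadj_comm hadjZ hadj_J2z rmorph_nat (mulmxBr _ (comm H Z)) (mulmxBl (comm _ H)).
  by rewrite !linearB /= mxtrace_comm_mul -scalemxAl -scalemxAr.
have trM Y Z : \tr (hadj Y *m comm M Z) = \tr (hadj (comm P Y) *m Z).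
  by rewrite hadj_comm mxtrace_comm_mul.
move=> /(congr1 (fun Y => \tr (hadj X *m Y))).
rewrite mulmx0 linear0 mulmxDr linearD /= trH trM => /eqP.
rewrite paddr_eq0 ?mxtrace_hadj_ge0 // => /andP[/eqP/mxtrace_hadj_eq0 HX /eqP/mxtrace_hadj_eq0 PX].
by apply: highest_weight => //; apply/eqP; rewrite -subr_eq0 -/(shiftH X) HX.
Qed.

(** The adjoint of J+^2 is J-^2, so this is orthogonality to J+^2. By invariance each summand
    vanishes, because J-^2 has weight -4 and commutes with J-. *)
Lemma highest_op_orth X : \tr (M *m M *m highest_op X) = 0.
Proof.
have trH Y : \tr (M *m M *m shiftH Y) = 0.
  rewrite (mulmxBr _ (comm H Y)) linearB /= mxtrace_comm_mul commC comm_J2z_JminusJminus.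
  by rewrite -scaleNr opprK -scalemxAl -scalemxAr subrr.
rewrite mulmxDr linearD /= trH mxtrace_comm_mul commMl commxx.
by rewrite mulmx0 mul0mx addr0 mul0mx linear0 addr0.
Qed.

(** * Complex Lie algebras containing J+ and J- *)

Section Subalgebra.
Variable W : {vspace 'M[C]_d}.
Hypothesis W_comm : forall X Y, X \in W -> Y \in W -> comm X Y \in W.
Hypotheses (WP : P \in W) (WM : M \in W).

Let WH : H \in W.
Proof. by rewrite -comm_Jplus_Jminus W_comm. Qed.

Lemma JplusJplus_mem X : X \in W -> \tr (M *m M *m X) != 0 -> P *m P \in W.
Proof.
move=> WX trX; pose N := linfun highest_op.
have NW : (N @: W <= W)%VS.
  apply/subvP=> _ /memv_imgP[Y WY ->]; rewrite lfunE /=.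
  have WU Z : Z \in W -> shiftH Z \in W by move=> WZ; rewrite memvB ?memvZ ?W_comm.
  by rewrite memvD ?WU ?W_comm.
(* If [N] were injective on [W], a dimension count would give N W = W, and X would lie in the image
   of [N], against [highest_op_orth]. Otherwise a nonzero kernel vector in [W] is a multiple of
   J+^2. *)
have [ker0|] := eqVneq (W :&: lker N)%VS 0%VS.
  have WN : (N @: W)%VS = W by apply/eqP; rewrite eqEdim NW (limg_dim_eq ker0) leqnn.
  move: WX trX; rewrite -{1}WN => /memv_imgP[Y _ ->].
  by rewrite lfunE /= highest_op_orth eqxx.
rewrite -vpick0; set Y := vpick _ => Y0.
have := memv_pick (W :&: lker N)%VS; rewrite -/Y memv_cap memv_ker lfunE.
move=> /andP[WY /eqP /highest_op_eq0 [c Yc]].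
have c0 : c != 0 by apply: contraNneq Y0 => c0; rewrite Yc c0 scale0r.
by move: WY; rewrite Yc => /(memvZ c^-1); rewrite scalerA mulVf // scale1r.
Qed.

(** The matrix is p(ad D) X for D the diagonal matrix of [q], because matrix units are eigenvectors
    of ad D. The induction is Horner's scheme. *)
Lemma poly_comm_mem (q : nat -> C) X (p : {poly C}) :
  up d 0 q \in W -> X \in W -> \matrix_(i, j) (p.[q i - q j] * X i j) \in W.
Proof.
move=> Wq WX; elim/poly_ind: p => [|p c IHp].
  rewrite (_ : \matrix_(i, j) _ = 0) ?mem0v //.
  by apply/matrixP=> i j; rewrite !mxE horner0 mul0r.
rewrite (_ : \matrix_(i, j) _ = comm (up d 0 q) (\matrix_(i, j) (p.[q i - q j] * X i j)) + c *: X).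
  by rewrite memvD ?memvZ ?W_comm.
by apply/matrixP=> i j; rewrite mxE [RHS]mxE comm_diagE !mxE hornerMXaddC; ring.
Qed.

(** Interpolation: a polynomial vanishing at every other difference of entries of [q] projects X
    onto the eigenspace of (i, j), where by separation X has a single nonzero entry. *)
Lemma delta_mem (q : nat -> C) X (i j : 'I_d) :
  up d 0 q \in W -> X \in W -> X i j != 0 ->
  (forall k l : 'I_d, X k l != 0 -> q k - q l = q i - q j -> k = i /\ l = j) ->
  delta_mx i j \in W.
Proof.
move=> Wq WX Xij sep; pose v (kl : 'I_d * 'I_d) := q kl.1 - q kl.2.
pose p := \prod_(kl | v kl != v (i, j)) ('X - (v kl)%:P).
have rootp k l : v (k, l) != v (i, j) -> p.[v (k, l)] = 0.
  by move=> kl; apply/eqP; rewrite /p (bigD1 (k, l)) //= hornerM hornerXsubC subrr mul0r.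
have pij : p.[v (i, j)] != 0.
  rewrite horner_prod prodf_seq_neq0; apply/allP=> kl _; apply/implyP=> neq.
  by rewrite hornerXsubC subr_eq0 eq_sym.
have := poly_comm_mem p Wq WX => /(memvZ (p.[v (i, j)] * X i j)^-1).
congr (_ \in W); apply/matrixP=> k l; rewrite !mxE -/(v (k, l)).
case: eqP => [->|ki]; first case: eqP => [->|lj] /=.
- by rewrite mulVf // mulf_neq0.
- have [->|Xil] := eqVneq (X i l) 0; first by rewrite !mulr0.
  have [/(sep _ _ Xil) [_ /lj]//|neq] := eqVneq (v (i, l)) (v (i, j)).
  by rewrite (rootp _ _ neq) mul0r mulr0.
have [->|Xkl] := eqVneq (X k l) 0; first by rewrite !mulr0.
have [/(sep _ _ Xkl) [/ki]//|neq] := eqVneq (v (k, l)) (v (i, j)).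
by rewrite (rootp _ _ neq) mul0r mulr0.
Qed.

Hypothesis WPP : P *m P \in W.

Lemma Jquad_mem : up d 0 quad \in W.
Proof. by rewrite -JquadE -comm_J2zJplus_Jminus -comm_JplusJplus_Jminus !W_comm. Qed.

Lemma quad_step j : quad j.+1 - quad j = 12 * (2 * j%:R - n.+1%:R).
Proof. by rewrite /quad; ring. Qed.

(** The steps of a quadratic polynomial form an arithmetic progression, here with common difference
    24, nonzero in characteristic 0. *)
Lemma quad_step_inj j k : quad j.+1 - quad j = quad k.+1 - quad k -> j = k.
Proof.
rewrite !quad_step => jk; apply/eqP; rewrite -(eqr_nat C) -subr_eq0.
suff /eqP : 24 * (j%:R - k%:R) = 0 :> C by rewrite mulf_eq0 pnatr_eq0.
move/eqP: jk; rewrite -subr_eq0 => /eqP <-; ring.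
Qed.

Lemma delta_step_mem (i j : 'I_d) : (i : nat) = j.+1 ->
  delta_mx i j \in W /\ delta_mx j i \in W.
Proof.
move=> ij; have lj : ladder j != 0 by rewrite ladder_neq0 // -ltnS -ij.
split.
  apply: (delta_mem Jquad_mem WP) => [|k l]; rewrite JplusE !mxE addn1.
    by rewrite ij eqxx.
  case: (_ =P l.+1) => [kl _|_ /eqP //].
  rewrite kl ij => /quad_step_inj lj'.
  by split; apply: val_inj; rewrite /= ?kl ?ij lj'.
apply: (delta_mem Jquad_mem WM) => [|k l]; rewrite JminusE !mxE addn1.
  by rewrite ij eqxx.
case: (_ =P k.+1) => [kl _|_ /eqP //].
(* The entries of J- lie above the diagonal, so the differences appear with the opposite sign. *)
rewrite kl ij => /(congr1 -%R); rewrite !opprB => /quad_step_inj lj'.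
by split; apply: val_inj; rewrite /= ?kl ?ij lj'.
Qed.

Lemma comm_delta (i j k : 'I_d) : i != k ->
  comm (delta_mx i j) (delta_mx j k) = delta_mx i k :> 'M[C]_d.
Proof.
by move=> ik; rewrite commE mul_delta_mx mul_delta_mx_0 ?subr0 // eq_sym.
Qed.

(** Induction on the distance to the diagonal: the unit at (i, j) is the commutator of those at (i,
    k) and (k, j), with k = i - 1. *)
Lemma delta_offdiag_mem (i j : 'I_d) : i != j -> delta_mx i j \in W.
Proof.
suff lower m : forall i j : 'I_d, (i : nat) = (j + m).+1 ->
    delta_mx i j \in W /\ delta_mx j i \in W.
  rewrite -val_eqE neq_ltn => /= /orP[ij|ij].
    have ji : (j : nat) = (i + (j - i).-1).+1 by lia.
    by case: (lower _ _ _ ji).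
  have ji : (i : nat) = (j + (i - j).-1).+1 by lia.
  by case: (lower _ _ _ ji).
elim: m => [|m IHm] {}i {}j ij; first by apply: delta_step_mem; rewrite ij addn0.
have ltk : ((j + m).+1 < d)%N by have := ltn_ord i; lia.
pose k : 'I_d := Ordinal ltk.
have [Wkj Wjk] := IHm k j erefl.
have [|Wik Wki] := @delta_step_mem i k; first by rewrite ij addnS.
have neq : i != j by rewrite -val_eqE /=; lia.
split; first by rewrite -(comm_delta k neq) W_comm.
by rewrite -(@comm_delta j k i) ?W_comm // eq_sym.
Qed.

Lemma traceless_mem X : \tr X = 0 -> X \in W.
Proof.
move=> trX.
(* The corrections on the diagonal add up to (tr X) E_00 = 0. *)
have -> : X = \sum_i \sum_j X i j *: (delta_mx i j - (i == j)%:R *: delta_mx 0 0).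
  rewrite {1}(matrix_sum_delta X); apply/eqP; rewrite -subr_eq0 -sumrB.
  rewrite (eq_bigr (fun i => X i i *: delta_mx 0 0)); last first.
    move=> i _; rewrite -sumrB (bigD1 i) //= big1 ?addr0 => [|j ji].
      by rewrite eqxx scale1r -scalerBr opprB addrC subrK.
    by rewrite eq_sym (negbTE ji) scale0r subr0 subrr.
  by rewrite -scaler_suml -/(\tr X) trX scale0r.
apply: memv_suml => i _; apply: memv_suml => j _; apply: memvZ.
have [->|ij] := eqVneq i j; last by rewrite scale0r subr0 delta_offdiag_mem.
rewrite scale1r; have [->|j0] := eqVneq j 0; first by rewrite subrr mem0v.
(* E_jj - E_00 is the commutator of E_j0 and E_0j. *)
have := W_comm (delta_offdiag_mem j0) (delta_offdiag_mem (_ : 0 != j)).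
by rewrite eq_sym j0 commE !mul_delta_mx => /(_ isT).
Qed.

End Subalgebra.

End SpinOperators.

(** * Spherical tensor operators of rank two *)

Section Tensor.
Variables (C : numClosedFieldType) (n : nat).
Local Notation d := n.+3.
Local Notation P := (Jplus : 'M[C]_d).
Local Notation M := (Jminus : 'M[C]_d).
Local Notation H := (J2z C n).

Lemma factr_neq0 m : (m`!)%:R != 0 :> C.
Proof. by rewrite pnatr_eq0 -lt0n fact_gt0. Qed.

Lemma ifact_nat (m : nat) : ifact C m%:Z = (m`!)%:R^-1.
Proof. by []. Qed.

Lemma zfact_nat (m : nat) : zfact C m%:Z = (m`!)%:R.
Proof. by []. Qed.

(** At m = 0 the convention 1/(-1)! = 0 agrees with the factor m. Here and in [ifact_sub2] this
    makes boundary columns obey the same polynomial formula as the others. *)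
Lemma ifact_sub1 (m : nat) : ifact C (m%:Z - 1) = m%:R / (m`!)%:R.
Proof.
case: m => [|m]; first by rewrite mul0r.
rewrite (_ : m.+1%:Z - 1 = m%:Z); last by lia.
rewrite ifact_nat factS natrM; field.
by rewrite factr_neq0 addrC natr1 pnatr_eq0.
Qed.

Lemma ifact_sub2 (m : nat) : ifact C (m%:Z - 2) = m%:R * (m%:R - 1) / (m`!)%:R.
Proof.
case: m => [|m]; first by rewrite !mul0r.
rewrite (_ : m.+1%:Z - 2 = m%:Z - 1); last by lia.
rewrite ifact_sub1 factS natrM; field.
by rewrite factr_neq0 addrC natr1 pnatr_eq0.
Qed.

(** Collects the factors of [Tsph 2 q] that depend neither on q nor on the column. *)
Definition norm2 : C :=
  sqrtC (5%:R / d%:R) * sqrtC (d%:R * zfact C 2%N%:Z * zfact C (d%:Z - 1 - 2%N%:Z)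
    * zfact C 2%N%:Z / zfact C (2%N%:Z + d%:Z)).

(* [a = J + m] and [b = J - m] for the weight [m] of the column;
   [aq], [bq], [kq], [kq'] stand for [a + q], [b - q], [2 - q], [2 + q]. *)
Definition racah2 (q : int) (a b aq bq kq kq' : nat) : C :=
  sqrtC ((aq`! * bq`! * kq`! * kq'`! * b`! * a`!)%N)%:R / ((a`!)%:R * (b`!)%:R) *
    ((kq`!)%:R^-1 * ifact C q * b%:R * (b%:R - 1) / 2
     - ifact C (1 - q) * ifact C (1 + q) * a%:R * b%:R
     + ifact C (- q) * (kq'`!)%:R^-1 * a%:R * (a%:R - 1) / 2).

(** The three terms s = 0, 1, 2 of the Racah sum, with integer arguments replaced by naturals so
    that the factorials can be simplified. *)
Lemma Tsph2E (q : int) (i j : 'I_d) (b aq bq kq kq' : nat) :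
  (j + b = n.+2)%N -> j%:Z + q = aq -> b%:Z - q = bq -> 2 - q = kq -> 2 + q = kq' ->
  i%:Z = j%:Z + q ->
  Tsph 2 q i j = norm2 * racah2 q j b aq bq kq kq'.
Proof.
move=> jb jq bqE kqE kqE' ij; rewrite mxE ij eqxx /CG.
rewrite /norm2 /racah2 -!mulrA; congr (_ * (_ * _)).
rewrite !big_ord_recr big_ord0 /=.
have -> : d%:Z - 1 = (j + b)%:Z by lia.
have -> : (j + b)%:Z - j%:Z = b%:Z by lia.
rewrite bqE.
have -> : 2%N%:Z - q = kq by lia.
have -> : 2%N%:Z + q = kq' by lia.
rewrite jq.
have -> : (j + b)%:Z - 2%N%:Z - j%:Z + 0%N%:Z = b%:Z - 2 by lia.
have -> : (j + b)%:Z - 2%N%:Z - j%:Z + 1%N%:Z = b%:Z - 1 by lia.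
have -> : (j + b)%:Z - 2%N%:Z - j%:Z + 2%N%:Z = b%:Z by lia.
have -> : 2%N%:Z - 0%N%:Z = 2%N%:Z by [].
have -> : 2%N%:Z - 1%N%:Z = 1%N%:Z by [].
have -> : 2%N%:Z - 2%N%:Z = 0%N%:Z by [].
have -> : kq%:Z - 0%N%:Z = kq%:Z by lia.
have -> : kq%:Z - 1%N%:Z = 1 - q by lia.
have -> : kq%:Z - 2%N%:Z = - q by lia.
have -> : j%:Z - 0%N%:Z = j%:Z by lia.
have -> : q + 0%N%:Z = q by lia.
have -> : q + 1%N%:Z = 1 + q by lia.
have -> : q + 2%N%:Z = kq' by lia.
rewrite (ifact_sub1 j) (ifact_sub2 j) (ifact_sub1 b) (ifact_sub2 b) !ifact_nat !zfact_nat.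
rewrite !natrM -!mulrA; congr (_ * _).
field.
by rewrite !factr_neq0.
Qed.

(** Nonnegativity of [L] selects the principal root. It is applied with [L] a constant times ladder
    coefficients. *)
Lemma sqrt_fact (a m : nat) (l : nat) (L : C) : 0 <= L ->
  l%:R = L ^+ 2 :> C ->
  sqrtC ((l * (a`! * m`!) ^ 2)%N)%:R = L * (a`!)%:R * (m`!)%:R.
Proof.
move=> L0 lL; rewrite -[RHS]sqrCK ?mulr_ge0 ?ler0n //; congr sqrtC.
by rewrite natrM lL natrX natrM !exprMn; ring.
Qed.

Lemma ladder_ge0 j : 0 <= ladder C n j.
Proof. by rewrite sqrtC_ge0 ler0n. Qed.

Lemma ladder_sqr j m : (j + m = n.+1)%N -> (ladder C n j) ^+ 2 = (m.+1 * j.+1)%:R.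
Proof. by move=> jm; rewrite sqrtCK; congr ((_ * _)%:R); lia. Qed.

Lemma Tsph2_up (q : nat) c f : (q <= 2)%N ->
  (forall a m, (a + q + m = n.+2)%N ->
     racah2 q a (m + q) (a + q) m (2 - q) (2 + q) = c * f a) ->
  Tsph 2 q = (norm2 * c) *: up d q f.
Proof.
move=> q2 cf; apply/matrixP=> i j; rewrite !mxE.
have [ij|ij] := eqVneq (i : nat) (j + q)%N; last first.
  by rewrite mulr0; case: eqP => //; move: ij => /eqP; lia.
have [m jm] : exists m, (j + q + m = n.+2)%N.
  by exists (n.+2 - (j + q))%N; have := ltn_ord i; lia.
rewrite -mulrA -(cf j m) // -(@Tsph2E q i j) ?mxE //; lia.
Qed.

(** Following the indexing of [dn], [a] is now the row and a + q the column. *)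
Lemma Tsph2_dn (q : nat) c f : (q <= 2)%N ->
  (forall a m, (a + q + m = n.+2)%N ->
     racah2 (- q%:Z) (a + q) m a (m + q) (2 + q) (2 - q) = c * f a) ->
  Tsph 2 (- q%:Z) = (norm2 * c) *: dn d q f.
Proof.
move=> q2 cf; apply/matrixP=> i j; rewrite !mxE.
have [ij|ij] := eqVneq (j : nat) (i + q)%N; last first.
  by rewrite mulr0; case: eqP => //; move: ij => /eqP; lia.
have [m jm] : exists m, (i + q + m = n.+2)%N.
  by exists (n.+2 - (i + q))%N; have := ltn_ord j; lia.
rewrite -mulrA -(cf i m) // -ij -(@Tsph2E (- q%:Z) i j) ?mxE //; lia.
Qed.

(** In this and the next four lemmas the radicand splits into (2 - q)! (2 + q)!, which is 24, 6 or
    4, the squared ladder coefficients, and (a! m!)^2. The bracket of [racah2] supplies the rest of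
    the constant. *)
Lemma Tsph2_p2 : exists c : C, Tsph 2 2 = c *: (P *m P).
Proof.
exists (norm2 * (sqrtC 24%:R / 4)); rewrite JplusE up_mul; apply: (@Tsph2_up 2) => // a m am.
rewrite /racah2 (_ : _ * _ = 24 * (m.+1 * a.+2 * (m.+2 * a.+1)) * (a`! * m`!) ^ 2)%N; last first.
  by rewrite (_ : (2 - 2)`! = 1)%N // (_ : (2 + 2)`! = 24)%N // !addn2 !factS; ring.
rewrite (@sqrt_fact _ _ _ (sqrtC 24%:R * (ladder C n a.+1 * ladder C n a))).
- move: (sqrtC _) => r; rewrite !addn2 addn1 /ifact /= !factS !fact0 !natrM ?mul0r; field.
  by rewrite ?nat1r -?natrD !factr_neq0 ?pnatr_eq0.
- by rewrite !mulr_ge0 ?ladder_ge0 // sqrtC_ge0 ler0n.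
- by rewrite !exprMn sqrtCK (@ladder_sqr _ m) ?(@ladder_sqr _ m.+1) ?natrM //; lia.
Qed.

Lemma Tsph2_m2 : exists c : C, Tsph 2 (- 2) = c *: (M *m M).
Proof.
exists (norm2 * (sqrtC 24%:R / 4)); rewrite JminusE dn_mul; apply: (@Tsph2_dn 2) => // a m am.
rewrite /racah2 (_ : _ * _ = 24 * (m.+1 * a.+2 * (m.+2 * a.+1)) * (a`! * m`!) ^ 2)%N; last first.
  by rewrite (_ : (2 - 2)`! = 1)%N // (_ : (2 + 2)`! = 24)%N // !addn2 !factS; ring.
rewrite (@sqrt_fact _ _ _ (sqrtC 24%:R * (ladder C n a.+1 * ladder C n a))).
- move: (sqrtC _) => r; rewrite !addn2 addn1 /ifact /= !factS !fact0 !natrM ?mul0r; field.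
  by rewrite ?nat1r -?natrD !factr_neq0 ?pnatr_eq0.
- by rewrite !mulr_ge0 ?ladder_ge0 // sqrtC_ge0 ler0n.
- by rewrite !exprMn sqrtCK (@ladder_sqr _ m) ?(@ladder_sqr _ m.+1) ?natrM //; lia.
Qed.

Lemma Tsph2_p1 : exists c : C, Tsph 2 1 = c *: (P *m H + H *m P).
Proof.
(* The bracket of [racah2] is (m + 1)(m - a) / 2 while the two weights add up to 2 (a - m), hence
   the minus sign. *)
exists (norm2 * (- sqrtC 6%:R / 4)); rewrite JplusE !up_mul upD; apply: (@Tsph2_up 1) => // a m am.
rewrite /racah2 (_ : _ * _ = 6 * (m.+1 * a.+1) * (a`! * m`!) ^ 2)%N; last first.
  by rewrite (_ : (2 - 1)`! = 1)%N // (_ : (2 + 1)`! = 6)%N // !addn1 !factS; ring.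
rewrite (@sqrt_fact _ _ _ (sqrtC 6%:R * ladder C n a)).
- move: (sqrtC _) => r; rewrite addn0 !addn1 /ifact /= !factS !fact0 !natrM ?mul0r
    /weight -am; field.
  by rewrite ?nat1r -?natrD !factr_neq0 ?pnatr_eq0.
- by rewrite !mulr_ge0 ?ladder_ge0 // sqrtC_ge0 ler0n.
- by rewrite !exprMn sqrtCK (@ladder_sqr _ m) ?natrM //; lia.
Qed.

Lemma Tsph2_m1 : exists c : C, Tsph 2 (- 1) = c *: (H *m M + M *m H).
Proof.
exists (norm2 * (sqrtC 6%:R / 4)); rewrite JminusE /J2z -dn0 !dn_mul dnD.
apply: (@Tsph2_dn 1) => // a m am.
rewrite /racah2 (_ : _ * _ = 6 * (m.+1 * a.+1) * (a`! * m`!) ^ 2)%N; last first.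
  by rewrite (_ : (2 - 1)`! = 1)%N // (_ : (2 + 1)`! = 6)%N // !addn1 !factS; ring.
rewrite (@sqrt_fact _ _ _ (sqrtC 6%:R * ladder C n a)).
- move: (sqrtC _) => r; rewrite addn0 !addn1 /ifact /= !factS !fact0 !natrM ?mul0r
    /weight -am; field.
  by rewrite ?nat1r -?natrD !factr_neq0 ?pnatr_eq0.
- by rewrite !mulr_ge0 ?ladder_ge0 // sqrtC_ge0 ler0n.
- by rewrite !exprMn sqrtCK (@ladder_sqr _ m) ?natrM //; lia.
Qed.

Lemma Tsph2_0 : exists c : C, Tsph 2 0 = c *: Jquad C n.
Proof.
exists (norm2 * (1 / 4)); rewrite JquadE; apply: (@Tsph2_up 0) => // a m am.
rewrite /racah2 (_ : _ * _ = 4 * (a`! * m`!) ^ 2)%N; last first.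
  by rewrite !addn0 (_ : 2`! = 2)%N //; ring.
rewrite (@sqrt_fact _ _ _ 2%:R).
- rewrite !addn0 /ifact /= !factS !fact0 /quad -am !natrD; field.
  by rewrite ?nat1r -?natrD !factr_neq0 ?pnatr_eq0.
- by rewrite ler0n.
- by rewrite -natrX.
Qed.

End Tensor.

(** * Generation of su(d) *)

Section Generation.
Variables (C : numClosedFieldType) (n : nat).
Local Notation d := n.+3.
Local Notation P := (Jplus : 'M[C]_d).
Local Notation M := (Jminus : 'M[C]_d).
Implicit Types X Y Z h : 'M[C]_d.

Lemma JplusJplus_mem_Tsph (W : {vspace 'M[C]_d}) h (q : int) :
  (forall X Y, X \in W -> Y \in W -> comm X Y \in W) ->
  P \in W -> M \in W -> h \in W ->
  -2 <= q <= 2 -> \tr (h *m Tsph 2 q) != 0 -> P *m P \in W.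
Proof.
move=> Wcomm WP WM Wh q2; pose ann Y := forall X, X \in W -> \tr (X *m Y) = 0.
have ann_comm Y : ann Y -> ann (comm P Y).
  by move=> annY X WX; rewrite mxtrace_comm_mul annY ?Wcomm.
have annZ a Y : ann Y -> ann (a *: Y).
  by move=> annY X WX; rewrite -scalemxAr linearZ /= annY ?mulr0.
have annZK a Y : a != 0 -> ann (a *: Y) -> ann Y.
  by move=> a0 /(annZ a^-1); rewrite scalerA mulVf ?scale1r.
(* Either some X in [W] pairs nontrivially with J-^2, or J-^2 annihilates [W]. In the latter case ad
   J+ carries the annihilation to all five components, contradicting the hypothesis on [h]. *)
have [annMM|/existsNP[X /not_implyP[WX /eqP trX]] _] := pselect (ann (M *m M)); last first.
  by apply: (JplusJplus_mem Wcomm WP WM WX); rewrite mxtrace_mulC.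
have ann1 := ann_comm _ annMM; rewrite comm_Jplus_JminusJminus in ann1.
have ann2 := ann_comm _ ann1; rewrite comm_Jplus_J2zJminus in ann2.
have ann3 := ann_comm _ ann2; rewrite comm_Jplus_Jquad in ann3.
have /annZK{}ann3 := ann3; rewrite oppr_eq0 pnatr_eq0 in ann3; have {}ann3 := ann3 isT.
have ann4 := ann_comm _ ann3; rewrite comm_Jplus_J2zJplus in ann4.
have /annZK{}ann4 := ann4; rewrite oppr_eq0 pnatr_eq0 in ann4; have {}ann4 := ann4 isT.
suff annT : ann (Tsph 2 q) by rewrite annT ?eqxx.
have [c2 T2] := Tsph2_p2 C n; have [c1 T1] := Tsph2_p1 C n.
have [c0 T0] := Tsph2_0 C n; have [c1' T1'] := Tsph2_m1 C n.
have [c2' T2'] := Tsph2_m2 C n.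
have : [|| q == 2, q == 1, q == 0, q == - 1 | q == - 2] by lia.
by case/or4P => [|||/orP[|]] /eqP ->; rewrite ?T2 ?T1 ?T0 ?T1' ?T2'; apply: annZ.
Qed.

Lemma mxtrace_Jplus : \tr P = 0.
Proof.
have /eqP := mxtrace_comm (J2z C n) P; rewrite comm_J2z_Jplus linearZ /=.
by rewrite mulf_eq0 pnatr_eq0 => /eqP.
Qed.

Lemma mxtrace_Jminus : \tr M = 0.
Proof. by rewrite mxtrace_hadj mxtrace_Jplus rmorph0. Qed.

Lemma su_lie_closed : lie_closed (@su C d).
Proof.
split=> [a X Y ra [hX tX] [hY tY] | X Y [hX tX] [hY tY]]; split.
- by rewrite hadjD hadjZ hX hY (CrealP ra) scalerN opprD.
- by rewrite linearD linearZ /= tX tY mulr0 addr0.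
- by rewrite -commE hadj_comm hX hY !commE !mulNmx !mulmxN !opprK opprB.
- by rewrite -commE mxtrace_comm.
Qed.

Lemma hermitian_su X : hadj X = X -> \tr X = 0 -> su (- 'i *: X).
Proof.
move=> hX tX; split; last by rewrite linearZ /= tX mulr0.
by rewrite hadjZ hX rmorphN /= conjCi opprK scaleNr opprK.
Qed.

Lemma hadj_Jx : hadj (Jx : 'M[C]_d) = Jx.
Proof.
by rewrite /Jx hadjZ hadjD hadj_Jplus hadj_Jminus addrC fmorphV rmorph_nat.
Qed.

Lemma hadj_Jy : hadj (Jy : 'M[C]_d) = Jy.
Proof.
rewrite /Jy hadjZ hadjB hadj_Jplus hadj_Jminus fmorphV rmorphM rmorph_nat /= conjCi.
by rewrite mulrN invrN scaleNr -scalerN opprB.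
Qed.

Lemma mxtrace_Jx : \tr (Jx : 'M[C]_d) = 0.
Proof. by rewrite linearZ linearD /= mxtrace_Jplus mxtrace_Jminus addr0 mulr0. Qed.

Lemma mxtrace_Jy : \tr (Jy : 'M[C]_d) = 0.
Proof. by rewrite linearZ linearB /= mxtrace_Jplus mxtrace_Jminus subr0 mulr0. Qed.

Lemma JplusJxy : P = Jx + 'i *: Jy.
Proof.
rewrite /Jx /Jy scalerA; apply/matrixP=> i j; rewrite !mxE; field.
by rewrite neq0Ci.
Qed.

Lemma JminusJxy : M = Jx - 'i *: Jy.
Proof.
rewrite /Jx /Jy scalerA; move: P M => X Y; apply/matrixP=> i j; rewrite !mxE; field.
by rewrite neq0Ci.
Qed.

(** * Descent from the complexified algebra *)

Section Complexification.
Variable T : 'M[C]_d -> Prop.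
Hypotheses (T_closed : lie_closed T) (T_su : forall X, T X -> su X).

Definition complexified Z := exists A B, [/\ T A, T B & Z = A + 'i *: B].

Lemma T_lin a X Y : a \is Num.real -> T X -> T Y -> T (a *: X + Y).
Proof. exact: T_closed.1. Qed.

Lemma T_sub X Y : T X -> T Y -> T (X - Y).
Proof. by move=> TX TY; rewrite addrC -scaleN1r; apply: T_lin; rewrite ?rpredN ?rpred1. Qed.

Lemma T_add X Y : T X -> T Y -> T (X + Y).
Proof. by move=> TX TY; rewrite -[X]scale1r; apply: T_lin; rewrite ?rpred1. Qed.

Lemma T_comm X Y : T X -> T Y -> T (comm X Y).
Proof. by rewrite commE; apply: T_closed.2. Qed.

Lemma complexified_lin a X Y :
  complexified X -> complexified Y -> complexified (a *: X + Y).
Proof.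
move=> [A [B [TA TB ->]]] [A' [B' [TA' TB' ->]]].
exists ('Re a *: A + (- 'Im a *: B + A')), ('Re a *: B + ('Im a *: A + B')).
split; try by do !apply: T_lin; rewrite ?rpredN ?Creal_Re ?Creal_Im.
rewrite {1}[a]Crect; apply/matrixP=> i j; rewrite !mxE.
rewrite [RHS](_ : _ = ('Re a + 'i * 'Im a) * A i j + 'i * 'Re a * B i j - 'Im a * B i j
  + A' i j + 'i * B' i j); last by ring.
by have := sqrCi C => ii; ring: ii.
Qed.

Lemma complexified_comm X Y :
  complexified X -> complexified Y -> complexified (comm X Y).
Proof.
move=> [A [B [TA TB ->]]] [A' [B' [TA' TB' ->]]].
exists (comm A A' - comm B B'), (comm A B' + comm B A').
split; [by apply: T_sub; apply: T_comm | by apply: T_add; apply: T_comm |].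
rewrite !commDl !commDr !commZl !commZr scalerA -expr2 sqrCi scaleN1r.
by apply/matrixP=> i j; rewrite !mxE; ring.
Qed.

(** The adjoint of A + iB is -A + iB; equating it with -A - iB gives B = 0. *)
Lemma su_complexified X : su X -> complexified X -> T X.
Proof.
move=> [hX _] [A [B [TA TB XE]]]; have [hA _] := T_su TA; have [hB _] := T_su TB.
move: hX; rewrite {1}XE hadjD hadjZ hA hB conjCi XE scaleNr scalerN opprK opprD.
move/addrI/eqP; rewrite -addr_eq0 -scalerDl -mulr2n scaler_eq0 mulrn_eq0 (negbTE (neq0Ci _)) /=.
by move=> /eqP ->; rewrite scaler0 addr0.
Qed.

End Complexification.

Lemma lie_generated_su h (q : int) : hadj h = h -> \tr h = 0 ->
  -2 <= q <= 2 -> \tr (h *m Tsph 2 q) != 0 ->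
  forall X, lie_generated [:: - 'i *: Jx; - 'i *: Jy; - 'i *: h] X <-> su X.
Proof.
move=> hh th q2 trh X.
have gens_su G : G \in [:: - 'i *: Jx; - 'i *: Jy; - 'i *: h] -> su G.
  rewrite !inE => /or3P[] /eqP ->; apply: hermitian_su => //.
  - exact: hadj_Jx.
  - exact: mxtrace_Jx.
  - exact: hadj_Jy.
  - exact: mxtrace_Jy.
split=> [genX|suX S S_closed S_gens]; first exact: genX su_lie_closed gens_su.
(* [S] may contain matrices that are not anti-Hermitian; intersecting with su(d) makes the descent
   from the complexification possible. *)
pose T Y := S Y /\ su Y.
have T_closed : lie_closed T.
  split=> [a Y Z ra [SY uY] [SZ uZ]|Y Z [SY uY] [SZ uZ]]; split.
  - exact: S_closed.1.
  - exact: su_lie_closed.1.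
  - exact: S_closed.2.
  - exact: su_lie_closed.2.
have T_gens G : G \in [:: - 'i *: Jx; - 'i *: Jy; - 'i *: h] -> T G.
  by move=> Gg; split; [exact: S_gens | exact: gens_su].
have Tx : T (- 'i *: Jx) by apply: T_gens; rewrite !inE eqxx.
have Ty : T (- 'i *: Jy) by apply: T_gens; rewrite !inE eqxx orbT.
have Th : T (- 'i *: h) by apply: T_gens; rewrite !inE eqxx !orbT.
have T0 : T 0 by rewrite -(subrr (- 'i *: h)); apply: T_sub.
have C0 : complexified T 0 by exists 0, 0; rewrite scaler0 addr0.
have iNi Y : 'i *: (- 'i *: Y) = Y by rewrite scalerA mulrN -expr2 sqrCi opprK scale1r.
have [W WE] := subspace_vspace C0 (complexified_lin T_closed).
have WM : M \in W.
  (* J- = Jx - i Jy, where Jx is i times the generator -i Jx. *)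
  apply/WE; exists (- 'i *: Jy), (- 'i *: Jx); split=> //.
  by rewrite iNi addrC JminusJxy scaleNr.
have WP : P \in W.
  apply/WE; exists (0 - (- 'i *: Jy)), (- 'i *: Jx); split=> //; first exact: T_sub.
  by rewrite iNi sub0r scaleNr opprK addrC JplusJxy.
have Wh : h \in W by apply/WE; exists 0, (- 'i *: h); rewrite iNi add0r.
have Wcomm Y Z : Y \in W -> Z \in W -> comm Y Z \in W.
  by move=> /WE CY /WE CZ; apply/WE; apply: complexified_comm.
have T_su Y : T Y -> su Y by case.
suff /WE/(su_complexified T_su suX)[] : X \in W by [].
 apply: (traceless_mem Wcomm WP WM); last by case: suX.
exact: JplusJplus_mem_Tsph Wcomm WP WM Wh q2 trh.
Qed.

End Generation.

Theorem theorem1 (R : realType) (d : nat) (h : 'M[R[i]]_d) :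
  (2 < d)%N ->
  hadj h = h ->
  \tr h = 0 ->
  (exists q : int, (-2 <= q <= 2) /\ \tr (h *m Tsph 2 q) != 0) ->
  forall X : 'M[R[i]]_d,
    lie_generated [:: - 'i *: Jx; - 'i *: Jy; - 'i *: h] X <-> su X.
Proof.
case: d h => [|[|[|n]]] // h _ hh th [q [q2 trh]].
exact: lie_generated_su hh th q2 trh.
Qed.
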